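(* For each $k\in\mathbb{N}_0$, let $\{g^k_j\mid j=0,\ldots,k\}$ be the orthogonal basis of the right $\mathbb{H}$-linear Hilbert space $\mathcal{M}_k(\mathbb{R}^3,\mathbb{H})$ uniquely determined by the conditions (i), (ii), (iii) listed in the context. Then, for each $j=0,\ldots,k$, $$g^k_j=\begin{cases}(-1)^l\,k!\,2^{-j}\left(\operatorname{Re}p^k_l-i_1\operatorname{Re}q^k_l+i_2\operatorname{Im}q^k_l+i_3\operatorname{Im}p^k_l\right),& j=2l,\\[4pt] (-1)^l\,k!\,2^{-j}\left(\operatorname{Re}q^k_{l+1}+i_1\operatorname{Re}p^k_l-i_2\operatorname{Im}p^k_l+i_3\operatorname{Im}q^k_{l+1}\right),& j=2l+1.\end{cases}$$ Here $u=y_1+iy_2$, $\overline{u}=y_1-iy_2$, and $p^k_l=p^k_l(u,\overline{u},y_0)$, $q^k_l=q^k_l(u,\overline{u},y_0)$ are the complex valued polynomials $$p^k_l(u,\overline{u},y_0)=\sum_{s=0}^{\min(l,k-l)}(-1)^s\frac{(2y_0)^{2s}\,u^{l-s}\,\overline{u}^{\,k-l-s}}{(2s)!(l-s)!(k-l-s)!},$$ $$q^k_l(u,\overline{u},y_0)=\sum_{s=0}^{\min(l-1,k-l)}(-1)^s\frac{(2y_0)^{2s+1}\,u^{l-1-s}\,\overline{u}^{\,k-l-s}}{(2s+1)!(l-1-s)!(k-l-s)!},$$ with $q^k_0=0=q^k_{k+1}$.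
   Context: $\mathbb{H}$ is the skew field of real quaternions $q=q_0+q_1i_1+q_2i_2+q_3i_3$ with $i_1^2=i_2^2=i_3^2=i_1i_2i_3=-1$, and $\overline{q}=q_0-q_1i_1-q_2i_2-q_3i_3$. $\mathbb{H}$ is realized as the algebra of complex $2\times2$ matrices $$q=\begin{pmatrix}q_0+iq_3&-q_2+iq_1\\ q_2+iq_1&q_0-iq_3\end{pmatrix},\quad i_1=\begin{pmatrix}0&i\\ i&0\end{pmatrix},\ i_2=\begin{pmatrix}0&-1\\1&0\end{pmatrix},\ i_3=\begin{pmatrix}i&0\\0&-i\end{pmatrix}.$$ The variable in $\mathbb{R}^3$ is $y=(y_0,y_1,y_2)$ and $D=\frac{\partial}{\partial y_0}+i_1\frac{\partial}{\partial y_1}+i_2\frac{\partial}{\partial y_2}$. $\mathcal{M}_k(\mathbb{R}^3,\mathbb{H})$ is the space of $\mathbb{H}$-valued $k$-homogeneous polynomials $Q$ on $\mathbb{R}^3$ with $DQ=0$, a right $\mathbb{H}$-linear Hilbert space with $\mathbb{H}$-valued inner product $(Q,R)_{\mathbb{H}}=\int_{S^2}\overline{Q}R\,d\sigma$. The conditions determining the polynomials $g^k_j\in\mathcal{M}_k(\mathbb{R}^3,\mathbb{H})$, $k\in\mathbb{N}_0$, $0\le j\le k$, are: (i) If $h^k_j$ and $h^k_{2k+1-j}$ denote the first and second column of the matrix valued polynomial $g^k_j$ ($j=0,\dots,k$), then $Hh^k_j=(k+\frac12-j)h^k_j$ for all $j=0,\dots,2k+1$, where $H=-i\left(\frac{i_3}2+y_2\frac{\partial}{\partial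 y_1}-y_1\frac{\partial}{\partial y_2}\right)$ (with $i_3$ acting on columns by matrix multiplication). (ii) $\frac{\partial g^k_j}{\partial y_0}=k\,g^{k-1}_{j-1}$ for $j=1,\dots,k$ and $\frac{\partial g^k_0}{\partial y_0}=0$. (iii) $g^k_0=(y_1-i_3y_2)^k$ for each $k\in\mathbb{N}_0$. There exists exactly one such system, and for each $k$ the set $\{g^k_j\mid j=0,\dots,k\}$ is an orthogonal basis of $\mathcal{M}_k(\mathbb{R}^3,\mathbb{H})$. *)

(* Defs.v *)
From HB Require Import structures.
From mathcomp Require Import all_boot all_order all_algebra.
From mathcomp Require Import reals.
From mathcomp Require Import complex mpoly.

Set Implicit Arguments.
Unset Strict Implicit.
Unset Printing Implicit Defensive.

Import GRing.Theory.
Local Open Scope ring_scope.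

(* A quaternion is a complex 2 x 2 matrix, so a quaternion valued polynomial on
   R^3 is a 2 x 2 matrix over C[y_0, y_1, y_2].  The polynomials are formal
   objects (no information is lost, R being infinite) and the partial
   derivatives are the formal ones; the variables stand for real numbers. *)
Notation rpoly R := {mpoly R[3]}.
Notation cpoly R := {mpoly (R[i])[3]}.

Section Quaternionic.
Variable R : realType.
Implicit Types (a b c d : rpoly R) (p u v y : cpoly R).

Definition iC : R[i] := Complex 0 1.

Definition x0 : 'I_3 := Ordinal (isT : (0 < 3)%N).
Definition x1 : 'I_3 := Ordinal (isT : (1 < 3)%N).
Definition x2 : 'I_3 := Ordinal (isT : (2 < 3)%N).

Definition y0 : cpoly R := 'X_x0.
Definition y1 : cpoly R := 'X_x1.
Definition y2 : cpoly R := 'X_x2.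

(* Since y_0, y_1, y_2 are real, the real and imaginary parts of a complex
   valued polynomial are obtained coefficientwise. *)
Definition rePoly p : rpoly R := map_mpoly (@complex.Re R) p.
Definition imPoly p : rpoly R := map_mpoly (@complex.Im R) p.
Definition toC a : cpoly R := map_mpoly (fun t : R => Complex t 0) a.

Definition mx2 p11 p12 p21 p22 : 'M[cpoly R]_2 :=
  \matrix_(r, s) (if r == 0 then if s == 0 then p11 else p12
                  else if s == 0 then p21 else p22).

Definition i1 : 'M[cpoly R]_2 := mx2 0 iC%:MP iC%:MP 0.
Definition i2 : 'M[cpoly R]_2 := mx2 0 (-1) 1 0.
Definition i3 : 'M[cpoly R]_2 := mx2 iC%:MP 0 0 (- iC%:MP).

Definition quat a b c d : 'M[cpoly R]_2 :=
  (toC a)%:M + toC b *: i1 + toC c *: i2 + toC d *: i3.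

Definition quatValued (Q : 'M[cpoly R]_2) : Prop :=
  exists a b c d, Q = quat a b c d.

Definition partial m n (x : 'I_3) (Q : 'M[cpoly R]_(m, n)) :
  'M[cpoly R]_(m, n) := map_mx (fun p => p^`M(x)) Q.

Definition Dop (Q : 'M[cpoly R]_2) : 'M[cpoly R]_2 :=
  partial x0 Q + i1 *m partial x1 Q + i2 *m partial x2 Q.

(* The underlying set of M_k(R^3, H). *)
Definition monogenic (k : nat) (Q : 'M[cpoly R]_2) : Prop :=
  [/\ quatValued Q, forall r s, Q r s \is k.-homog & Dop Q = 0].

Definition Hop (h : 'cV[cpoly R]_2) : 'cV[cpoly R]_2 :=
  - iC%:MP *: ((2^-1)%:MP *: (i3 *m h)
               + y2 *: partial x1 h - y1 *: partial x2 h).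

Section System.
Variable g : nat -> nat -> 'M[cpoly R]_2.

(* For k < j <= 2k+1, h^k_j is the second column of g^k_(2k+1-j). *)
Definition hcol (k j : nat) : 'cV[cpoly R]_2 :=
  if (j <= k)%N then col 0 (g k j) else col 1 (g k (2 * k + 1 - j)%N).

(* Values g k j with j > k are irrelevant.  These conditions determine all
   g k j with j <= k; that the g k j, j <= k, form an orthogonal basis for the
   L^2(S^2) inner product is a consequence of them, not a further condition. *)
Definition gSystem : Prop :=
  [/\ forall k j, (j <= k)%N -> monogenic k (g k j),
      forall k j, (j <= 2 * k + 1)%N ->
        Hop (hcol k j) = (k%:R + 2^-1 - j%:R)%:MP *: hcol k j,
      (forall k j, (1 <= j <= k)%N ->
         partial x0 (g k j) = k%:R *: g k.-1 j.-1) /\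
      (forall k, partial x0 (g k 0%N) = 0)
    & forall k, g k 0%N = (y1%:M - y2 *: i3) ^+ k].
End System.

Definition uvar : cpoly R := y1 + iC%:MP * y2.
Definition ubar : cpoly R := y1 - iC%:MP * y2.

(* Meaningful for l <= k only. *)
Definition pfun (k l : nat) u v y : cpoly R :=
  \sum_(0 <= s < (minn l (k - l)).+1)
    ((-1) ^+ s / ((2 * s)`! * (l - s)`! * (k - l - s)`!)%:R)%:MP
    * (2%:R * y) ^+ (2 * s) * u ^+ (l - s) * v ^+ (k - l - s).

(* For l = 0 and l = k+1 the range of summation in the formula is empty;
   truncated subtraction would not see this, hence the test. *)
Definition qfun (k l : nat) u v y : cpoly R :=
  if (1 <= l <= k)%N then
    \sum_(0 <= s < (minn (l - 1) (k - l)).+1)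
      ((-1) ^+ s / ((2 * s + 1)`! * (l - 1 - s)`! * (k - l - s)`!)%:R)%:MP
      * (2%:R * y) ^+ (2 * s + 1) * u ^+ (l - 1 - s) * v ^+ (k - l - s)
  else 0.

Definition pkl (k l : nat) : cpoly R := pfun k l uvar ubar y0.
Definition qkl (k l : nat) : cpoly R := qfun k l uvar ubar y0.

End Quaternionic.

Arguments i1 {R}.
Arguments i2 {R}.
Arguments i3 {R}.

(* Main.v *)
Require Import Defs.
From HB Require Import structures.
From mathcomp Require Import all_boot all_order all_algebra.
From mathcomp Require Import reals.
From mathcomp Require Import complex mpoly.
From mathcomp Require Import ring zify.

(** A quaternion is determined by its first column, so only the first columns
    (a, b) of the matrices g^k_j have to be computed.  For such a column,
    homogeneity gives Euler's identity
      (y_0 d_0 + y_1 d_1 + y_2 d_2) f = k f     for f = a and f = b,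
    condition (i) prescribes (y_2 d_1 - y_1 d_2) f, the equation D g = 0 ties
    (d_1 - i d_2) a to d_0 b and (d_1 + i d_2) b to d_0 a, and condition (ii)
    identifies d_0 a and d_0 b with k a' and k b', where (a', b') is the first
    column of g^(k-1)_(j-1).  In a suitable combination of these relations
    every derivative disappears, and what is left is the purely algebraic
    recurrence
      j a = k (i u b' + y_0 a'),   (2k+1-j) b = k (i ubar a' + y_0 b'),
    which is [first_column_step].  As j and 2k+1-j are nonzero for
    1 <= j <= k, it determines everything from the columns at j = 0, given by
    condition (iii).

    It remains to see that the announced polynomials obey the same recurrence.
    Writing w = 2 y_0 and x^[n] = x^n / n!, both p^k_l and q^k_l have the form
      sum_s (-1)^s w^[2s+e] u^[A-s] ubar^[B-s]
    with e = 0 or 1, and the recurrence becomes the two identities [dsum_even]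
    and [dsum_odd], each a consequence of n x^[n] = x x^[n-1] applied in every
    term.  The induction on j alternates between even and odd values:
    [odd_of_even] and [even_of_odd]. *)

Set Implicit Arguments.
Unset Strict Implicit.
Unset Printing Implicit Defensive.

Import GRing.Theory Num.Theory.
Local Open Scope ring_scope.

(** * Alternating sums of divided powers *)

Section DividedPowers.
Variables (K : numFieldType) (A : comAlgType K).
Implicit Types (u v w x : A).

(** The divided power x^[n-1].  The shift of the index leaves room for the
    value 0 at index 0, so that with truncated subtraction [dpow (n - s)] is
    x^[n-1-s], read as 0 when the exponent n-1-s is negative. *)
Definition dpow n x : A := if n is m.+1 then (m`!%:R)^-1 *: x ^+ m else 0.

Lemma dpowS n x : n%:R * dpow n.+1 x = x * dpow n x.
Proof.
case: n => [|n]; first by rewrite mul0r mulr0.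
rewrite /= -!scalerAr -exprS mulr_natl -scalerMnr scalerMnl; congr (_ *: _).
by rewrite factS natrM invfM -[LHS]mulr_natl mulrA divff ?mul1r ?pnatr_eq0.
Qed.

(** The common shape of p^k_l (e = 0, L = l+1, M = k-l+1) and q^k_l (e = 1,
    L = l, M = k+1-l), taken at w = 2 y_0.  The sum is empty if L or M is 0,
    which yields q^k_0 = 0 = q^k_(k+1). *)
Definition dsum e L M w u v : A :=
  \sum_(0 <= s < minn L M)
    (-1) ^+ s * (dpow (2 * s + e).+1 w * dpow (L - s) u * dpow (M - s) v).

(** Sums with different L and M can be compared term by term once they have a
    common range; the added terms contain a divided power of index 0. *)
Lemma dsum_widen N e L M w u v : (minn L M <= N)%N ->
  dsum e L M w u v =
  \sum_(0 <= s < N)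
    (-1) ^+ s * (dpow (2 * s + e).+1 w * dpow (L - s) u * dpow (M - s) v).
Proof.
move=> leN; rewrite [RHS](big_cat_nat _ leN) //= [X in _ + X]big1_seq ?addr0 //.
move=> s /andP[_]; rewrite mem_index_iota geq_min => /andP[/orP[] h _].
  by rewrite (_ : L - s = 0)%N ?mulr0 ?mul0r ?mulr0 //; lia.
by rewrite (_ : M - s = 0)%N ?mulr0 ?mul0r ?mulr0 //; lia.
Qed.

Lemma dsum_sym e L M w u v : dsum e L M w u v = dsum e M L w v u.
Proof. by rewrite /dsum minnC; apply: eq_bigr => s _; rewrite mulrAC. Qed.

Lemma dsum0 e M w u v : dsum e 0 M w u v = 0.
Proof. by rewrite /dsum min0n big_nil. Qed.

(** In the term of index s write 2L = 2(L-s) + 2s and use [dpowS] twice: the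
    factor L-s is absorbed by the power of u, the factor 2s by the power of w.
    The second part has no term for s = 0, and moving its index by one
    produces the sum with e = 1, with the opposite sign. *)
Lemma dsum_even L M w u v :
  (2 * L)%:R * dsum 0 L.+1 M w u v =
  2 * u * dsum 0 L M w u v - w * dsum 1 L M.-1 w u v.
Proof.
rewrite !(@dsum_widen L.+1 0) ?(@dsum_widen L 1) ?geq_min ?leqnn ?leqnSn //.
pose t s :=
  (-1) ^+ s * (dpow (2 * s).+1 w * dpow (L.+1 - s) u * dpow (M - s) v).
have -> : - (w * \sum_(0 <= s < L) (-1) ^+ s *
    (dpow (2 * s + 1).+1 w * dpow (L - s) u * dpow (M.-1 - s) v)) =
    \sum_(0 <= s < L.+1) (2 * s)%:R * t s.
  rewrite big_nat_recl // muln0 mul0r add0r mulr_sumr -sumrN.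
  apply: eq_bigr => s _; rewrite /t subSS.
  rewrite (_ : M - s.+1 = M.-1 - s)%N; last by lia.
  rewrite (_ : 2 * s.+1 = (2 * s + 1).+1)%N; last by lia.
  have := dpowS (2 * s + 1).+1 w.
  set a := dpow _.+2 w; set b := dpow _ w => /esym h.
  by rewrite exprS; ring: h.
rewrite !mulr_sumr -big_split /=; apply: eq_big_nat => s /andP[_ lesL].
rewrite addn0 /t subSn //; have := dpowS (L - s) u.
set a := dpow _.+1 u; set b := dpow (L - s) u => /esym h.
rewrite natrB // in h.
ring: h.
Qed.

(** As for [dsum_even], with 2L+1 = 2(L-s) + (2s+1); here the exponent of w is
    odd, hence positive, and no shift of the index occurs. *)
Lemma dsum_odd L M w u v :
  (2 * L + 1)%:R * dsum 1 L.+1 M w u v =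
  2 * u * dsum 1 L M w u v + w * dsum 0 L.+1 M w u v.
Proof.
rewrite !(@dsum_widen L.+1) ?geq_min ?leqnn ?leqnSn //.
rewrite !mulr_sumr -big_split /=; apply: eq_big_nat => s /andP[_ lesL].
rewrite addn0 subSn // (addn1 (2 * s)).
have := dpowS (L - s) u; have := dpowS (2 * s).+1 w.
set a := dpow _.+1 u; set b := dpow (L - s) u.
set c := dpow _.+2 w; set d := dpow _ w.
rewrite natrB // => /esym h1 /esym h2.
ring: h1 h2.
Qed.

End DividedPowers.

(** * Euler's identity *)

Lemma mpoly_euler n (A : comNzRingType) d (p : {mpoly A[n]}) :
  p \is d.-homog -> \sum_(i < n) 'X_i * p^`M(i) = d%:R * p.
Proof.
move=> /dhomogP hp; rewrite {2}(mpolyE p) mulr_sumr.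
under eq_bigr => i _ do rewrite {1}(mpolyE p) raddf_sum mulr_sumr.
rewrite exchange_big /=; apply: eq_big_seq => m /hp <-; rewrite /= mdegE.
rewrite natr_sum mulr_suml; apply: eq_bigr => i _.
rewrite mderivZ mderivX -!scalerAr scalerA mulr_natl -scaler_nat scalerA.
(* the truncated subtraction m - U_(i) is a true one unless m i = 0, and then
   both sides vanish *)
case: (posnP (m i)) => [->|mi_gt0]; first by rewrite mulr0 !scale0r.
rewrite -mpolyXD addmC submK //.
by apply/mnm_lepP => k; rewrite mnm1E; case: eqP => // <-.
Qed.

Lemma sum_ord3 (V : nmodType) (F : 'I_3 -> V) :
  \sum_(i < 3) F i = F x0 + F x1 + F x2.
Proof.
rewrite !big_ord_recl big_ord0 addr0 addrA.
by congr (F _ + F _ + F _); apply: val_inj.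
Qed.

(** * Elimination of the derivatives *)

Section Elimination.
Variable A : comPzRingType.
Implicit Types (I h K J N C x y r s t : A).

(** The last three hypotheses are the eigenvalue equation, the component of
    D g = 0 that involves d_1 a and d_2 a (here a1 and a2), and Euler's
    identity; condition (ii) has replaced d_0 a, d_0 b by K a', K b'.
    Subtracting the eigenvalue equation from Euler's identity leaves the
    combination (y_1 + i y_2)(a1 - i a2), which D g = 0 expresses by b'. *)
Lemma top_entry I h K J (y0 y1 y2 a a1 a2 a' b' : A) :
  I * I = -1 ->
  - I * (h * (I * a) + y2 * a1 - y1 * a2) = (K + h - J) * a ->
  K * b' + I * a1 + a2 = 0 ->
  y0 * (K * a') + y1 * a1 + y2 * a2 = K * a ->
  J * a = K * (I * (y1 + I * y2) * b' + y0 * a').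
Proof.
move=> I2 eigen dirac euler.
have -> : J * a = K * a - (K + h - J) * a + h * a by ring.
have ea2 : a2 = - (K * b') - I * a1.
  by apply/eqP; rewrite -subr_eq0 -dirac; apply/eqP; ring.
by rewrite -eigen -euler ea2; ring: I2.
Qed.

(** The counterpart of [top_entry] for the other component; i_3 acts on it with
    the opposite sign, so the two halves h now add up to 1. *)
Lemma bottom_entry I h K J (y0 y1 y2 b b1 b2 a' b' : A) :
  I * I = -1 -> 2 * h = 1 ->
  - I * (h * - (I * b) + y2 * b1 - y1 * b2) = (K + h - J) * b ->
  K * a' + I * b1 - b2 = 0 ->
  y0 * (K * b') + y1 * b1 + y2 * b2 = K * b ->
  (2 * K + 1 - J) * b = K * (I * (y1 - I * y2) * a' + y0 * b').
Proof.
move=> I2 h2 eigen dirac euler.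
have -> : (2 * K + 1 - J) * b = K * b + (K + h - J) * b + h * b.
  have -> : 2 * K + 1 - J = 2 * K + 2 * h - J by rewrite h2.
  by ring.
have eb2 : b2 = K * a' + I * b1 by apply/eqP; rewrite eq_sym -subr_eq0 dirac.
by rewrite -eigen -euler eb2; ring: I2.
Qed.

(** The right-hand sides of the recurrence when the preceding column has the
    form C' (r, I t); [next_top] and [next_bottom] identify the next column as
    C (s1, I s2) from the identities of divided powers for s1 and s2. *)
Lemma next_top I K N C C' x y r t s :
  I * I = -1 -> K * C' = 2 * C -> N * s = 2 * y * r - 2 * x * t ->
  K * (I * x * (C' * I * t) + y * (C' * r)) = N * (C * s).
Proof.
move=> I2 coefE sE; rewrite [RHS]mulrCA sE.
transitivity (K * C' * (y * r - x * t)); first by ring: I2.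
by rewrite coefE; ring.
Qed.

Lemma next_bottom I K N C C' x y r t s :
  K * C' = 2 * C -> N * s = 2 * x * r + 2 * y * t ->
  K * (I * x * (C' * r) + y * (C' * I * t)) = N * (C * I * s).
Proof.
move=> coefE sE; rewrite [RHS]mulrCA sE.
transitivity (K * C' * I * (x * r + y * t)); first by ring.
by rewrite coefE; ring.
Qed.

End Elimination.

Section Columns.
Variable R : realType.

Local Notation I := ((iC R)%:MP : cpoly R).
Local Notation u := (uvar R).
Local Notation v := (ubar R).
Local Notation y0 := (y0 R).
Local Notation y1 := (y1 R).
Local Notation y2 := (y2 R).

Lemma sqr_I : I * I = -1.
Proof. by rewrite -mpolyCM -expr2 sqr_i mpolyCN. Qed.

Lemma nat_neq0 n : n.+1%:R != 0 :> cpoly R.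
Proof. by rewrite -mpolyC_nat mpolyC_eq0 pnatr_eq0. Qed.

(** * The operators on the first column *)

Lemma mx2_mulE n (p q r s : cpoly R) (Q : 'M[cpoly R]_(2, n)) c :
  ((mx2 p q r s *m Q) 0 c = p * Q 0 c + q * Q 1 c) *
  ((mx2 p q r s *m Q) 1 c = r * Q 0 c + s * Q 1 c).
Proof.
by split; rewrite mxE !big_ord_recl big_ord0 addr0 !mxE /=;
   rewrite (_ : lift ord0 ord0 = 1) //; apply: val_inj.
Qed.

Lemma i1_mulE n (Q : 'M[cpoly R]_(2, n)) c :
  ((i1 *m Q) 0 c = I * Q 1 c) * ((i1 *m Q) 1 c = I * Q 0 c).
Proof. by rewrite /i1; split; rewrite mx2_mulE mul0r ?add0r ?addr0. Qed.

Lemma i2_mulE n (Q : 'M[cpoly R]_(2, n)) c :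
  ((i2 *m Q) 0 c = - Q 1 c) * ((i2 *m Q) 1 c = Q 0 c).
Proof.
rewrite /i2; split; rewrite mx2_mulE mul0r.
  by rewrite add0r mulN1r.
by rewrite addr0 mul1r.
Qed.

Lemma i3_mulE n (Q : 'M[cpoly R]_(2, n)) c :
  ((i3 *m Q) 0 c = I * Q 0 c) * ((i3 *m Q) 1 c = - (I * Q 1 c)).
Proof.
by rewrite /i3; split; rewrite mx2_mulE mul0r ?add0r ?addr0 ?mulNr.
Qed.

Lemma partialE m n x (Q : 'M[cpoly R]_(m, n)) r s :
  partial x Q r s = (Q r s)^`M(x).
Proof. exact: mxE. Qed.

Lemma Dop_col (Q : 'M[cpoly R]_2) c :
  (Dop Q 0 c = (Q 0 c)^`M(x0) + I * (Q 1 c)^`M(x1) - (Q 1 c)^`M(x2)) *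
  (Dop Q 1 c = (Q 1 c)^`M(x0) + I * (Q 0 c)^`M(x1) + (Q 0 c)^`M(x2)).
Proof.
rewrite /Dop; split; rewrite [LHS]mxE [X in X + _]mxE; congr (_ + _ + _).
1,4: exact: partialE.
1,3: by rewrite i1_mulE partialE.
all: by rewrite i2_mulE partialE.
Qed.

Lemma Hop_col (h : 'cV[cpoly R]_2) :
  (Hop h 0 0 = - I * ((2^-1)%:MP * (I * h 0 0) +
     y2 * (h 0 0)^`M(x1) - y1 * (h 0 0)^`M(x2))) *
  (Hop h 1 0 = - I * ((2^-1)%:MP * - (I * h 1 0) +
     y2 * (h 1 0)^`M(x1) - y1 * (h 1 0)^`M(x2))).
Proof.
rewrite /Hop; split; rewrite [LHS]mxE; congr (_ * _);
  rewrite [LHS]mxE [X in X + _]mxE; congr (_ + _ + _).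
1,4: by rewrite mxE i3_mulE.
1,3: by rewrite mxE partialE.
all: by rewrite 2!mxE partialE.
Qed.

(** * The polynomials of the formula and its initial column *)

Lemma dpow_prod s a b c (w x y : cpoly R) :
  ((-1) ^+ s / (a`! * b`! * c`!)%:R)%:MP * w ^+ a * x ^+ b * y ^+ c =
  (-1) ^+ s * (dpow a.+1 w * dpow b.+1 x * dpow c.+1 y).
Proof.
by rewrite /= !natrM !invfM -!mul_mpolyC !mpolyCM rmorph_sign; ring.
Qed.

Lemma pklE k l : pkl R k l = dsum 0 l.+1 (k - l).+1 (2 * y0) u v.
Proof.
rewrite /pkl /pfun /dsum minnSS; apply: eq_big_nat => s /andP[_].
rewrite ltnS leq_min => /andP[lesl leskl].
by rewrite dpow_prod (subSn lesl) (subSn leskl) addn0.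
Qed.

Lemma qklE k l : (l <= k.+1)%N ->
  qkl R k l = dsum 1 l (k.+1 - l) (2 * y0) u v.
Proof.
rewrite leq_eqVlt /qkl /qfun => /predU1P[->|].
  by rewrite ltnn andbF subnn dsum_sym dsum0.
case: l => [|l]; first by rewrite dsum0.
rewrite ltnS => ltlk; rewrite ltlk !subSS subn0 /dsum.
have -> : (minn l (k - l.+1)).+1 = minn l.+1 (k - l) by lia.
apply: eq_big_nat => s /andP[_ /[!leq_min]/andP[lesl leskl]].
rewrite dpow_prod.
have -> : (l - s).+1 = (l.+1 - s)%N by lia.
by have -> : (k - l.+1 - s).+1 = (k - l - s)%N by lia.
Qed.

Lemma pkl0 k : pkl R k 0 = (k`!%:R^-1)%:MP * v ^+ k.
Proof.
rewrite /pkl /pfun min0n big_nat1 muln0 !subn0 fact0 !mul1n.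
by rewrite !expr0 !mulr1 mul1r.
Qed.

(** The matrix y_1 - y_2 i_3 is diagonal with entries ubar and u. *)
Lemma initial_column k :
  (((y1%:M - y2 *: i3) ^+ k : 'M[cpoly R]_2) 0 0 = v ^+ k) *
  (((y1%:M - y2 *: i3) ^+ k : 'M[cpoly R]_2) 1 0 = 0).
Proof.
have -> : y1%:M - y2 *: i3 = mx2 v 0 0 u :> 'M[cpoly R]_2.
  apply/matrixP => -[[|[|r]] hr] // [[|[|s]] hs] //;
    rewrite !mxE /= /uvar /ubar ?mulr1n ?mulr0n ?mulr0 ?subr0 //.
  - by rewrite mulrC.
  - by rewrite mulrN opprK mulrC.
elim: k => [|k IH]; first by rewrite expr0 !mxE.
rewrite exprS -mulmxE.
by split; rewrite mx2_mulE !IH mul0r ?addr0 ?add0r ?mulr0 ?exprS.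
Qed.

Definition coef k l j : R[i] := (-1) ^+ l * k`!%:R * 2 ^- j.

Lemma coef_odd k l :
  k.+1%:R * (coef k l (2 * l))%:MP
  = 2 * (coef k.+1 l (2 * l).+1)%:MP :> cpoly R.
Proof.
rewrite -!mpolyC_nat -!mpolyCM; congr _%:MP.
by rewrite /coef factS natrM exprS; field; rewrite expf_neq0 ?pnatr_eq0.
Qed.

Lemma coef_even k l :
  k.+1%:R * (coef k l (2 * l).+1)%:MP
  = - (2 * (coef k.+1 l.+1 (2 * l).+2)%:MP) :> cpoly R.
Proof.
rewrite -!mpolyC_nat -!mpolyCM -mpolyCN; congr _%:MP.
by rewrite /coef factS natrM !exprS; field; rewrite expf_neq0 ?pnatr_eq0.
Qed.

(** * The recurrence and its solution *)

Section System.
Variables (g : nat -> nat -> 'M[cpoly R]_2) (hg : gSystem g).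

(** Homogeneity, D g = 0 and conditions (i), (ii) are read off on the first
    column of g^(k+1)_(j+1), and the derivatives are eliminated by [top_entry]
    and [bottom_entry]. *)
Lemma first_column_step k j : (j <= k)%N ->
  (j.+1%:R * g k.+1 j.+1 0 0 =
     k.+1%:R * (I * u * g k j 1 0 + y0 * g k j 0 0)) *
  ((2 * k + 2 - j)%:R * g k.+1 j.+1 1 0 =
     k.+1%:R * (I * v * g k j 0 0 + y0 * g k j 1 0)).
Proof.
case: hg => hM hH [h0 _] _ lejk.
have [_ homQ DQ0] := hM k.+1 j.+1 lejk.
have euler r : y0 * (g k.+1 j.+1 r 0)^`M(x0) + y1 * (g k.+1 j.+1 r 0)^`M(x1)
    + y2 * (g k.+1 j.+1 r 0)^`M(x2) = k.+1%:R * g k.+1 j.+1 r 0.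
  have <- := mpoly_euler (homQ r 0).
  by rewrite (sum_ord3 (fun i => 'X_i * _^`M(i))).
have dy0 r : (g k.+1 j.+1 r 0)^`M(x0) = k.+1%:R * g k j r 0.
  have := congr1 (fun M : 'M[_]_2 => M r 0) (h0 k.+1 j.+1 lejk).
  by rewrite partialE mxE.
have eH := hH k.+1 j.+1; rewrite /hcol ltnS lejk in eH.
have {}eH : Hop (col 0 (g k.+1 j.+1)) = _ := eH ltac:(lia).
have colE r : col 0 (g k.+1 j.+1) r 0 = g k.+1 j.+1 r 0 by rewrite mxE.
have scaleE (c : cpoly R) (h : 'cV[cpoly R]_2) r : (c *: h) r 0 = c * h r 0.
  by rewrite mxE.
have cE : (k.+1%:R + 2^-1 - j.+1%:R)%:MP
    = k.+1%:R + (2^-1)%:MP - j.+1%:R :> cpoly R.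
  by rewrite mpolyCB mpolyCD !mpolyC_nat.
have h2 : 2 * (2^-1)%:MP = 1 :> cpoly R.
  by rewrite -mpolyC_nat -mpolyCM divff ?mpolyC1 ?pnatr_eq0.
have eH0 := congr1 (fun M : 'cV[_]_2 => M 0 0) eH.
have eH1 := congr1 (fun M : 'cV[_]_2 => M 1 0) eH.
have {}eH0 := etrans (esym (Hop_col _).1) eH0.
have {}eH1 := etrans (esym (Hop_col _).2) eH1.
have eD0 := congr1 (fun M : 'M[_]_2 => M 0 0) DQ0.
have eD1 := congr1 (fun M : 'M[_]_2 => M 1 0) DQ0.
have {}eD0 := etrans (esym (Dop_col _ _).1) eD0.
have {}eD1 := etrans (esym (Dop_col _ _).2) eD1.
rewrite /= scaleE colE cE in eH0.
rewrite /= scaleE colE cE in eH1.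
rewrite /= dy0 mxE in eD0.
rewrite /= dy0 mxE in eD1.
have e0 := euler 0; have e1 := euler 1; rewrite !dy0 in e0 e1.
split; first exact: top_entry sqr_I eH0 eD1 e0.
rewrite -[RHS](bottom_entry sqr_I h2 eH1 eD0 e1); congr (_ * _).
by rewrite natrB; [ring | lia].
Qed.

Lemma next_entries k j (C C' r t s1 s2 : cpoly R) : (j <= k)%N ->
  g k j 0 0 = C' * r -> g k j 1 0 = C' * I * t -> k.+1%:R * C' = 2 * C ->
  j.+1%:R * s1 = 2 * y0 * r - 2 * u * t ->
  (2 * k + 2 - j)%:R * s2 = 2 * v * r + 2 * y0 * t ->
  g k.+1 j.+1 0 0 = C * s1 /\ g k.+1 j.+1 1 0 = C * I * s2.
Proof.
move=> lejk ea eb coefE s1E s2E; have [] := first_column_step lejk.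
rewrite {}ea {}eb (next_top sqr_I coefE s1E) (next_bottom _ coefE s2E).
have [n ->] : exists n, (2 * k + 2 - j = n.+1)%N.
  by exists (2 * k + 1 - j)%N; lia.
by move=> /(mulfI (nat_neq0 _)) -> /(mulfI (nat_neq0 _)) ->.
Qed.

Definition even_entries l := forall k, (2 * l <= k)%N ->
  g k (2 * l)%N 0 0 = (coef k l (2 * l))%:MP * pkl R k l /\
  g k (2 * l)%N 1 0 = (coef k l (2 * l))%:MP * I * - qkl R k l.

Definition odd_entries l := forall k, (2 * l < k)%N ->
  g k (2 * l).+1 0 0 = (coef k l (2 * l).+1)%:MP * qkl R k l.+1 /\
  g k (2 * l).+1 1 0 = (coef k l (2 * l).+1)%:MP * I * pkl R k l.

Lemma even_entries0 : even_entries 0.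
Proof.
move=> k _; case: hg => _ _ _ /(_ k) ->; rewrite !initial_column pkl0; split.
  rewrite mulrA -mpolyCM /coef expr0 mul1r expr0 invr1 mulr1.
  by rewrite divff ?mpolyC1 ?mul1r // pnatr_eq0 -lt0n fact_gt0.
by rewrite qklE // dsum0 oppr0 mulr0.
Qed.

(** The top entry falls under [dsum_odd].  In the bottom entry the variables u
    and ubar exchange their roles, and so do the indices l and k-l; after this
    exchange it falls under [dsum_even]. *)
Lemma odd_of_even l : even_entries l -> odd_entries l.
Proof.
move=> IH [|k] lelk; first by rewrite ltn0 in lelk.
have le2lk : (2 * l <= k)%N by lia.
have lelk' : (l <= k)%N by lia.
have [ea eb] := IH k le2lk.
apply: next_entries le2lk ea eb (coef_odd k l) _ _;
  rewrite !pklE !qklE; try lia; rewrite ?subSS (subSn lelk').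
  by rewrite -(addn1 (2 * l)) [LHS]dsum_odd [in RHS]mulrN opprK [RHS]addrC.
have -> : (2 * k + 2 - 2 * l = (2 * (k - l).+1))%N by lia.
by rewrite mulrN !(dsum_sym _ l.+1) (dsum_sym _ l) dsum_even.
Qed.

(** Here the top entry falls under [dsum_even] and the bottom entry, after the
    exchange of u and ubar, under [dsum_odd]. *)
Lemma even_of_odd l : odd_entries l -> even_entries l.+1.
Proof.
move=> IH [|k] lelk; first by rewrite leqn0 mulnS in lelk.
have le2lk : (2 * l < k)%N by lia.
have lelk' : (l <= k)%N by lia.
have [ea eb] := IH k le2lk.
have -> : (2 * l.+1)%N = (2 * l).+2 by lia.
set c := (coef _ _ _)%:MP.
have coefE : k.+1%:R * (coef k l (2 * l).+1)%:MP = 2 * - c.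
  by rewrite coef_even mulrN.
(* the sign (-1)^l changes in this step, hence the constant - c *)
suff [-> ->] : g k.+1 (2 * l).+2 0 0 = - c * - pkl R k.+1 l.+1 /\
    g k.+1 (2 * l).+2 1 0 = - c * I * qkl R k.+1 l.+1.
  by split; [exact: mulrNN | rewrite 2!mulNr -mulrN].
apply: next_entries le2lk ea eb coefE _ _;
  rewrite !pklE !qklE; try lia; rewrite !subSS ?(subSn lelk').
  rewrite (_ : (2 * l).+2 = (2 * l.+1)%N); last by lia.
  by rewrite mulrN dsum_even opprB.
have -> : (2 * k + 2 - (2 * l).+1 = 2 * (k - l) + 1)%N by lia.
by rewrite !(dsum_sym _ l.+1) dsum_odd.
Qed.

Lemma column_entries l : even_entries l /\ odd_entries l.
Proof.
elim: l => [|l [_ /even_of_odd ev]]; split=> //; try exact: odd_of_even.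
- exact: even_entries0.
- exact/odd_of_even/even_entries0.
Qed.

End System.
End Columns.

(** * A quaternion from its first column *)

Section FirstColumn.
Variable R : realType.
Local Notation I := ((iC R)%:MP : cpoly R).
Implicit Types (a b c d : rpoly R) (p q : cpoly R) (t : R).

Lemma mcoeff_toC a m : (toC a)@_m = (a@_m)%:C%C.
Proof. exact: (mcoeff_map_mpoly (real_complex R)). Qed.

Lemma mcoeff_rePoly p m : (rePoly p)@_m = complex.Re p@_m.
Proof. exact: mcoeff_map_mpoly. Qed.

Lemma mcoeff_imPoly p m : (imPoly p)@_m = complex.Im p@_m.
Proof. exact: mcoeff_map_mpoly. Qed.

Lemma mcoeff_toC2 a b m : (toC a + I * toC b)@_m = Complex a@_m b@_m.
Proof.
rewrite mcoeffD (mcoeffCM (iC R) (toC b)).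
transitivity ((a@_m)%:C%C + iC R * (b@_m)%:C%C).
  by congr (_ + _ * _); apply: mcoeff_toC.
by rewrite /iC; simpc.
Qed.

Lemma rePoly_toC2 a b : rePoly (toC a + I * toC b) = a.
Proof. by apply/mpolyP => m; rewrite mcoeff_rePoly mcoeff_toC2. Qed.

Lemma imPoly_toC2 a b : imPoly (toC a + I * toC b) = b.
Proof. by apply/mpolyP => m; rewrite mcoeff_imPoly mcoeff_toC2. Qed.

Lemma rePolyZ t p : rePoly (t%:C%C%:MP * p) = t%:MP * rePoly p.
Proof.
apply/mpolyP => m; rewrite mcoeffCM !mcoeff_rePoly mcoeffCM.
by case: p@_m => x y /=; ring.
Qed.

Lemma imPolyZ t p : imPoly (t%:C%C%:MP * p) = t%:MP * imPoly p.
Proof.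
apply/mpolyP => m; rewrite mcoeffCM !mcoeff_imPoly mcoeffCM.
by case: p@_m => x y /=; ring.
Qed.

Lemma rePolyI p : rePoly (I * p) = - imPoly p.
Proof.
apply/mpolyP => m; rewrite mcoeffN mcoeff_imPoly mcoeff_rePoly mcoeffCM.
by case: p@_m => x y /=; ring.
Qed.

Lemma imPolyI p : imPoly (I * p) = rePoly p.
Proof.
apply/mpolyP => m; rewrite mcoeff_imPoly mcoeff_rePoly mcoeffCM.
by case: p@_m => x y /=; ring.
Qed.

Lemma toCN a : toC (- a) = - toC a.
Proof. exact: (raddfN (map_mpoly (real_complex R))). Qed.

Lemma toCZ t a : toC (t%:MP * a) = t%:C%C%:MP * toC a.
Proof. by rewrite !mul_mpolyC; exact: (map_mpolyZ (real_complex R)). Qed.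

Lemma scale_mx2E (s p11 p12 p21 p22 : cpoly R) :
  ((s *: mx2 p11 p12 p21 p22) 0 0 = s * p11) *
  ((s *: mx2 p11 p12 p21 p22) 1 0 = s * p21).
Proof. by split; rewrite mxE mxE. Qed.

Lemma quat_top a b c d : quat a b c d 0 0 = toC a + I * toC d.
Proof.
transitivity (toC a + toC b * 0 + toC c * 0 + toC d * I); last first.
  by move: (toC a) (toC b) (toC c) (toC d) I => *; ring.
rewrite /quat [LHS]mxE [X in X + _]mxE [X in X + _ + _]mxE.
congr (_ + _ + _ + _); try exact: (scale_mx2E _ _ _ _ _).1.
by rewrite mxE.
Qed.

Lemma quat_bottom a b c d : quat a b c d 1 0 = toC c + I * toC b.
Proof.
transitivity (0 + toC b * I + toC c * 1 + toC d * 0); last first.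
  by move: (toC b) (toC c) (toC d) I => *; ring.
rewrite /quat [LHS]mxE [X in X + _]mxE [X in X + _ + _]mxE.
congr (_ + _ + _ + _); try exact: (scale_mx2E _ _ _ _ _).2.
by rewrite mxE.
Qed.

Lemma quat_column (Q : 'M[cpoly R]_2) : quatValued Q ->
  Q = quat (rePoly (Q 0 0)) (imPoly (Q 1 0)) (rePoly (Q 1 0)) (imPoly (Q 0 0)).
Proof.
case=> [a [b [c [d eQ]]]].
have eT : Q 0 0 = toC a + I * toC d by rewrite eQ; exact: quat_top.
have eB : Q 1 0 = toC c + I * toC b by rewrite eQ; exact: quat_bottom.
have -> : rePoly (Q 0 0) = a by rewrite eT; exact: rePoly_toC2.
have -> : rePoly (Q 1 0) = c by rewrite eB; exact: rePoly_toC2.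
have -> : imPoly (Q 1 0) = b by rewrite eB; exact: imPoly_toC2.
have -> : imPoly (Q 0 0) = d by rewrite eT; exact: imPoly_toC2.
exact: eQ.
Qed.

Lemma quatZ t a b c d :
  quat (t%:MP * a) (t%:MP * b) (t%:MP * c) (t%:MP * d) =
  t%:C%C%:MP *: quat a b c d.
Proof.
have scaleE (s x y z w x' y' z' w' : cpoly R) (X Y Z : 'M[cpoly R]_2) :
    x' = s * x -> y' = s * y -> z' = s * z -> w' = s * w ->
    x'%:M + y' *: X + z' *: Y + w' *: Z =
    s *: (x%:M + y *: X + z *: Y + w *: Z).
  by move=> -> -> -> ->; rewrite !scalerDr scale_scalar_mx !scalerA.
by apply: scaleE; exact: toCZ.
Qed.

(** The factor t has to be real: only then does it commute with taking the
    real and imaginary parts of the entries. *)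
Lemma quat_of_column (Q : 'M[cpoly R]_2) t p q : quatValued Q ->
  Q 0 0 = t%:C%C%:MP * p -> Q 1 0 = t%:C%C%:MP * I * q ->
  Q = t%:C%C%:MP *:
    ((toC (rePoly p))%:M + toC (rePoly q) *: i1 - toC (imPoly q) *: i2
     + toC (imPoly p) *: i3).
Proof.
move=> /quat_column eQ e0; rewrite -mulrA => e1.
have e00 : rePoly (Q 0 0) = t%:MP * rePoly p by rewrite e0; exact: rePolyZ.
have e01 : imPoly (Q 0 0) = t%:MP * imPoly p by rewrite e0; exact: imPolyZ.
have e10 : rePoly (Q 1 0) = t%:MP * - imPoly q.
  by rewrite e1 -rePolyI; exact: rePolyZ.
have e11 : imPoly (Q 1 0) = t%:MP * rePoly q.
  by rewrite e1 -imPolyI; exact: imPolyZ.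
rewrite {}eQ e00 e01 e10 e11 quatZ; congr (_ *: _).
by rewrite /quat toCN scaleNr.
Qed.

Lemma quat_of_columnN (Q : 'M[cpoly R]_2) t p q : quatValued Q ->
  Q 0 0 = t%:C%C%:MP * p -> Q 1 0 = t%:C%C%:MP * I * - q ->
  Q = t%:C%C%:MP *:
    ((toC (rePoly p))%:M - toC (rePoly q) *: i1 + toC (imPoly q) *: i2
     + toC (imPoly p) *: i3).
Proof.
move=> hQ e0 e1; rewrite (quat_of_column hQ e0 e1); congr (_ *: _).
have signE (y z y' z' : cpoly R) (X Y Z W : 'M[cpoly R]_2) :
    y' = - y -> z' = - z ->
    X + y' *: Y - z' *: Z + W = X - y *: Y + z *: Z + W.
  by move=> -> ->; rewrite !scaleNr opprK.
apply: signE; rewrite -toCN; congr toC; exact: raddfN.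
Qed.

Lemma coef_real k l j :
  coef R k l j = ((-1) ^+ l * k`!%:R * 2 ^- j : R)%:C%C.
Proof.
by rewrite /coef !rmorphM rmorph_sign rmorph_nat fmorphV rmorphXn rmorph_nat.
Qed.

End FirstColumn.

Theorem corollary4 (R : realType) (g : nat -> nat -> 'M[cpoly R]_2)
  (hg : gSystem g) (k j : nat) (hjk : (j <= k)%N) (l : nat) :
  (j = (2 * l)%N ->
     g k j = ((-1) ^+ l * (k`!)%:R * 2 ^- j)%:MP *:
       ((toC (rePoly (pkl R k l)))%:M
        - toC (rePoly (qkl R k l)) *: i1
        + toC (imPoly (qkl R k l)) *: i2
        + toC (imPoly (pkl R k l)) *: i3)) /\
  (j = (2 * l + 1)%N ->
     g k j = ((-1) ^+ l * (k`!)%:R * 2 ^- j)%:MP *: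
       ((toC (rePoly (qkl R k (l + 1))))%:M
        + toC (rePoly (pkl R k l)) *: i1
        - toC (imPoly (pkl R k l)) *: i2
        + toC (imPoly (qkl R k (l + 1))) *: i3)).
Proof.
have [even odd] := column_entries hg l.
have [hM _ _ _] := hg; have [hQ _ _] := hM k j hjk.
split=> ej; rewrite -/(coef R k l j).
  have := even k; rewrite -ej => /(_ hjk)[e0 e1].
  rewrite coef_real in e0 e1 *.
  exact: quat_of_columnN hQ e0 e1.
rewrite (addn1 l); rewrite addn1 in ej; have := odd k.
rewrite -ej => /(_ hjk)[e0 e1].
rewrite coef_real in e0 e1 *.
exact: quat_of_column hQ e0 e1.
Qed.
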